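(* Let $f:\mathbb{R}\to\mathbb{C}$ be a 1-periodic function whose Fourier series $f(x)=\sum_{k\in\mathbb{Z}} c_k e^{2\pi i k x}$ converges absolutely (i.e. $\sum_{k\in\mathbb{Z}}|c_k|<\infty$), and let $P\ge 2$ be an integer. Then $$\sum_{k\in\mathbb{Z}\setminus\{0\}} c_k\,\tilde{\chi}_P\!\left(\frac kP\right)=\sum_{l\in\mathbb{Z}\setminus\{0\}} c_{lP},$$ where $\tilde{\chi}_P(y)=\frac1P\sum_{j=0}^{P-1}e^{2\pi i y j}$.
   Context: The Fourier coefficients are $c_k=\int_0^1 f(x)e^{-2\pi i k x}\,dx$, and $f(x)$ equals the sum of its Fourier series for every $x\in\mathbb{R}$. The complex resonance function is $\tilde{\chi}_P(y)=\frac1P\sum_{j=0}^{P-1}e^{2\pi i y j}$ for $y\in\mathbb{R}$. *)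

(* Defs.v *)
From Stdlib Require Import Reals ZArith List Lra.
From Coquelicot Require Import Coquelicot.
Import ListNotations.

Open Scope R_scope.

(** Finite subsets of [D] are duplicate-free lists of elements of [D]; the
    filter consists of the properties that hold for all sufficiently large
    finite subsets, where "large" refers to inclusion. *)
Definition finite_subset (D : Z -> Prop) (L : list Z) : Prop :=
  NoDup L /\ forall k, In k L -> D k.

Definition finite_subsets (D : Z -> Prop) (Q : list Z -> Prop) : Prop :=
  exists L0, finite_subset D L0 /\
    forall L, finite_subset D L -> incl L0 L -> Q L.

(** [is_sum D a s] : the unordered sum of [a k] over [k] in [D] converges to
    [s].  No order of summation is fixed, so for real or complex terms this is
    absolute convergence, together with the value of the sum. *)
Definition is_sum {K : AbsRing} {V : NormedModule K}
    (D : Z -> Prop) (a : Z -> V) (s : V) : Prop :=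
  filterlim (fun L => fold_right plus zero (map a L))
    (finite_subsets D) (locally s).

Definition ex_sum {K : AbsRing} {V : NormedModule K}
    (D : Z -> Prop) (a : Z -> V) : Prop :=
  exists s, is_sum D a s.

Definition all_int (k : Z) : Prop := True.
Definition nonzero_int (k : Z) : Prop := k <> 0%Z.

(** Coquelicot has no complex exponential; this is e^x (cos y + i sin y). *)
Definition Cexp (z : C) : C :=
  (exp (Re z) * cos (Im z), exp (Re z) * sin (Im z)).

(** [RInt] is total.  A function that is everywhere the sum of an absolutely
    convergent trigonometric series is continuous, so for such functions the
    Riemann integral exists and agrees with the Lebesgue integral. *)
Definition fourier_coeff (f : R -> C) (k : Z) : C :=
  RInt (V := C_R_CompleteNormedModule)
    (fun x => (f x * Cexp (- (2 * PI * Ci * IZR k * x)))%C) 0 1.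

Definition resonance (P : nat) (y : R) : C :=
  (/ INR P * sum_n (fun j => Cexp (2 * PI * Ci * y * INR j)) (P - 1))%C.

Global Instance finite_subsets_filter (D : Z -> Prop) :
  ProperFilter (finite_subsets D).
Proof.
split.
- intros Q (L0 & HL0 & H); exists L0; apply H; [exact HL0 | apply incl_refl].
- split.
  + exists []; split; [split; [constructor | intros k []] | easy].
  + intros Q1 Q2 (L1 & [N1 D1] & H1) (L2 & [N2 D2] & H2).
    exists (nodup Z.eq_dec (L1 ++ L2)); split.
    * split; [apply NoDup_nodup |].
      intros k Hk; apply nodup_In, in_app_or in Hk; destruct Hk; auto.
    * intros L HL HI; split; [apply H1 | apply H2]; try exact HL;
        intros k Hk; apply HI, nodup_In, in_or_app; auto.
  + intros Q1 Q2 HQ (L0 & HL0 & H); exists L0; split; [exact HL0 |].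
    intros L HL HI; apply HQ, H; assumption.
Qed.

Lemma is_sum_unique {K : AbsRing} {V : NormedModule K}
    (D : Z -> Prop) (a : Z -> V) (s t : V) :
  is_sum D a s -> is_sum D a t -> s = t.
Proof. apply filterlim_locally_unique. Qed.

(* Main.v *)
Require Import Defs.
From Stdlib Require Import Reals ZArith.
From Coquelicot Require Import Coquelicot.
From Stdlib Require Import List FinFun Lra Lia.
Open Scope R_scope.

(** The resonance function at [k / P] is a mean of [P]-th roots of unity, so it
    is the indicator of the multiples of [P] ([resonance_multiple],
    [resonance_not_multiple]): the first family of the theorem vanishes off the
    multiples of [P], where its terms are those of the second family, and
    [is_sum_reindex] along [l |-> l P] turns one sum into the other.

    It remains to see that the first sum converges unconditionally.  For each
    [j] the terms [c_k e^(2 pi i k j / P)] are those of the Fourier series of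
    [f] at the point [j / P], which is summable to [f (j / P)].  Averaging these
    finitely many families over [0 <= j < P] gives a family with terms
    [c_k * resonance P (k / P)], indexed by all integers, whose sum is the mean
    of the values [f (j / P)]; deleting the index [0] keeps it summable.  Thus
    the common value is [1/P * sum_j f (j / P) - c_0]. *)

(** * Unordered sums *)

Section UnorderedSums.

Context {K : AbsRing} {V : NormedModule K}.
Implicit Types (D E : Z -> Prop) (a b : Z -> V) (s t : V).

Lemma is_sum_ext D a b s :
  (forall k, D k -> a k = b k) -> is_sum D a s -> is_sum D b s.
Proof.
intros Hab; apply filterlim_ext_loc.
exists nil; split; [split; [constructor | intros k []] |].
intros L [_ HL] _; f_equal; apply map_ext_in; auto.
Qed.

Lemma is_sum_plus D a b s t :
  is_sum D a s -> is_sum D b t ->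
  is_sum D (fun k => plus (a k) (b k)) (plus s t).
Proof.
intros Ha Hb; unfold is_sum.
apply filterlim_ext with
  (f := fun L => plus (fold_right plus zero (map a L))
                      (fold_right plus zero (map b L))).
- intros L; induction L as [|k L IH]; simpl.
  + apply plus_zero_l.
  + refine (eq_trans _ (f_equal (plus _) IH)).
    rewrite <- !plus_assoc; f_equal.
    rewrite !plus_assoc; f_equal; apply plus_comm.
- exact (filterlim_comp_2 _ _ _ Ha Hb (filterlim_plus s t)).
Qed.

Lemma is_sum_scal D (c : K) a s :
  is_sum D a s -> is_sum D (fun k => scal c (a k)) (scal c s).
Proof.
intros Ha; unfold is_sum.
apply filterlim_ext with
  (f := fun L => scal c (fold_right plus zero (map a L))).
- intros L; induction L as [|k L IH]; simpl.
  + exact (scal_zero_r c).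
  + refine (eq_trans _ (f_equal (plus _) IH)); exact (scal_distr_l c _ _).
- exact (filterlim_comp _ _ _ _ _ _ _ _ Ha (filterlim_scal_r c s)).
Qed.

Lemma is_sum_sum_n D (a : nat -> Z -> V) (s : nat -> V) (n : nat) :
  (forall j, is_sum D (a j) (s j)) ->
  is_sum D (fun k => sum_n (fun j => a j k) n) (sum_n s n).
Proof.
intros Ha; induction n as [|n IH].
- rewrite sum_O; apply is_sum_ext with (2 := Ha 0%nat).
  intros k _; now rewrite sum_O.
- rewrite sum_Sn; apply is_sum_ext with (2 := is_sum_plus _ _ _ _ _ IH (Ha (S n))).
  intros k _; now rewrite sum_Sn.
Qed.

(** Prepending [d] sends arbitrarily large finite subsets of [E] to arbitrarily
    large finite subsets of [D], and changes each partial sum by [a d]. *)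
Lemma is_sum_remove D E a s (d : Z) :
  D d -> (forall k, E k <-> D k /\ k <> d) ->
  is_sum D a s -> is_sum E a (minus s (a d)).
Proof.
intros Hd HE Ha; unfold is_sum.
apply filterlim_ext with
  (f := fun L => plus (fold_right plus zero (map a (d :: L))) (opp (a d))).
{ intros L; simpl.
  rewrite (plus_comm (a d)), <- plus_assoc.
  refine (eq_trans (f_equal (plus _) (plus_opp_r (a d))) _).
  apply plus_zero_r. }
assert (Hcons : filterlim (cons d) (finite_subsets E) (finite_subsets D)).
{ intros Q (L0 & [N0 D0] & HQ); exists (remove Z.eq_dec d L0); split; [split |].
  - clear - N0; induction N0 as [|x L Hx HN IH]; simpl; [constructor |].
    destruct (Z.eq_dec d x); [exact IH |].
    constructor; [intros H; apply in_remove in H; tauto | exact IH].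
  - intros k Hk; apply in_remove in Hk; apply HE; split; [apply D0 |]; tauto.
  - intros L [NL DL] HL; apply HQ.
    + split.
      * constructor; [| exact NL].
        intros H; apply DL, HE in H; now destruct H.
      * intros k [<- | Hk]; [exact Hd | now apply HE, DL].
    + intros k Hk; destruct (Z.eq_dec k d) as [-> | Hkd]; [now left |].
      right; apply HL, in_in_remove; auto. }
exact (filterlim_comp_2 _ _ _
         (filterlim_comp _ _ _ _ _ _ _ _ Hcons Ha)
         (filterlim_const (opp (a d))) (filterlim_plus s (opp (a d)))).
Qed.

(** A finite subset [L] of [E] is compared with the finite subset of [D] made of
    its image and of those elements of a prescribed list [L0] that lie outside
    the range of [phi]: the latter contribute zero, and as soon as [L] contains
    the preimage of [L0] this subset of [D] contains [L0]. *)
Lemma is_sum_reindex D E (phi psi : Z -> Z) a s :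
  (forall l, psi (phi l) = l) ->
  (forall l, E l <-> D (phi l)) ->
  (forall k, D k -> phi (psi k) <> k -> a k = zero) ->
  is_sum D a s -> is_sum E (fun l => a (phi l)) s.
Proof.
intros Hpsi HE Hzero Ha Q HQ.
destruct (Ha Q HQ) as (L0 & [N0 D0] & HL0).
set (out := fun k => negb (Z.eqb (phi (psi k)) k)).
assert (Hout : forall k, out k = true <-> phi (psi k) <> k).
{ intros k; unfold out; rewrite Bool.negb_true_iff; apply Z.eqb_neq. }
assert (Hin : forall k, out k = false -> phi (psi k) = k).
{ intros k; unfold out; rewrite Bool.negb_false_iff; apply Z.eqb_eq. }
exists (nodup Z.eq_dec (map psi (filter (fun k => negb (out k)) L0))); split.
- split; [apply NoDup_nodup |].
  intros l Hl; apply nodup_In, in_map_iff in Hl as (k & <- & Hk).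
  apply filter_In in Hk as [Hk Hb]; apply Bool.negb_true_iff, Hin in Hb.
  apply HE; rewrite Hb; auto.
- intros L [NL EL] HL.
  assert (Hsum : fold_right plus zero (map (fun l => a (phi l)) L) =
                 fold_right plus zero (map a (filter out L0 ++ map phi L))).
  { rewrite <- (map_map phi a).
    assert (Hf : forall k, In k (filter out L0) -> a k = zero).
    { intros k Hk; apply filter_In in Hk as [Hk Hb]; apply Hzero, Hout; auto. }
    induction (filter out L0) as [|k M IH]; simpl; [reflexivity |].
    rewrite (Hf k), plus_zero_l by (now left).
    apply IH; intros; apply Hf; now right. }
  unfold filtermap; cbv beta; rewrite Hsum; apply HL0.
  + split.
    * apply NoDup_app.
      -- now apply NoDup_filter.
      -- apply Injective_map_NoDup; [| exact NL].
         intros x y Hxy; rewrite <- (Hpsi x), <- (Hpsi y); now f_equal.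
      -- intros k Hk Hk'; apply filter_In in Hk as [_ Hk]; apply Hout in Hk.
         apply in_map_iff in Hk' as (l & <- & _); now rewrite Hpsi in Hk.
    * intros k Hk; apply in_app_or in Hk as [Hk | Hk].
      -- apply filter_In in Hk as [Hk _]; auto.
      -- apply in_map_iff in Hk as (l & <- & Hl); now apply HE, EL.
  + intros k Hk; apply in_or_app; destruct (out k) eqn:Hb.
    * left; now apply filter_In.
    * right; rewrite <- (Hin k Hb); apply in_map, HL, nodup_In, in_map.
      apply filter_In; now rewrite Hb.
Qed.

End UnorderedSums.

(** * Roots of unity *)

Definition unit_exp (y : R) : C := Cexp (2 * PI * Ci * y)%C.

Lemma unit_exp_eq (y : R) :
  unit_exp y = (cos (2 * PI * y), sin (2 * PI * y)).
Proof.
unfold unit_exp, Cexp; simpl.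
(* The left-hand sides are the expanded real and imaginary parts of the
   complex product [2 PI Ci y]. *)
replace (((2 * PI - 0 * 0) * 0 - (2 * 0 + 0 * PI) * 1) * y -
  ((2 * PI - 0 * 0) * 1 + (2 * 0 + 0 * PI) * 0) * 0) with 0 by ring.
replace (((2 * PI - 0 * 0) * 0 - (2 * 0 + 0 * PI) * 1) * 0 +
  ((2 * PI - 0 * 0) * 1 + (2 * 0 + 0 * PI) * 0) * y) with (2 * PI * y) by ring.
now rewrite exp_0, !Rmult_1_l.
Qed.

Lemma unit_exp_plus (x y : R) :
  unit_exp (x + y) = (unit_exp x * unit_exp y)%C.
Proof.
rewrite !unit_exp_eq, Rmult_plus_distr_l, cos_plus, sin_plus.
unfold Cmult; simpl; f_equal; ring.
Qed.

Lemma unit_exp_eq_1 (y : R) :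
  unit_exp y = 1%C <-> exists m : Z, y = IZR m.
Proof.
rewrite unit_exp_eq; pose proof PI_RGT_0 as Hpi; split.
- intros H; apply (f_equal fst) in H; simpl in H.
  replace (2 * PI * y) with (2 * (PI * y)) in H by ring.
  rewrite cos_2a_sin in H.
  destruct (sin_eq_0_0 (PI * y)) as [m Hm]; [nra |].
  exists m; apply Rmult_eq_reg_l with PI; lra.
- intros [m ->].
  replace (2 * PI * IZR m) with (2 * (IZR m * PI)) by ring.
  rewrite cos_2a_sin, sin_2a, (sin_eq_0_1 (IZR m * PI)) by (now exists m).
  apply injective_projections; simpl; ring.
Qed.

(** The geometric sum of ratio [unit_exp y], cleared of its denominator. *)
Lemma unit_exp_geometric (y : R) (n : nat) :
  ((unit_exp y - 1) * sum_n (fun j => unit_exp (y * INR j)) n =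
   unit_exp (y * INR (S n)) - 1)%C.
Proof.
induction n as [|n IH].
- rewrite sum_O; simpl (INR 1); simpl (INR 0).
  rewrite Rmult_1_r, Rmult_0_r.
  rewrite (proj2 (unit_exp_eq_1 0)) by (now exists 0%Z).
  ring.
- rewrite sum_Sn; change plus with Cplus.
  rewrite Cmult_plus_distr_l, IH.
  rewrite (S_INR (S n)), Rmult_plus_distr_l, Rmult_1_r, unit_exp_plus.
  ring.
Qed.

(** * The resonance function *)

Lemma resonance_eq (P : nat) (y : R) :
  resonance P y =
  (/ INR P * sum_n (fun j => unit_exp (y * INR j)) (P - 1))%C.
Proof.
unfold resonance; f_equal; apply sum_n_ext; intros j.
unfold unit_exp; rewrite RtoC_mult; f_equal; ring.
Qed.

Lemma INR_neq_0_C (P : nat) : (0 < P)%nat -> RtoC (INR P) <> 0%C.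
Proof.
intros HP H; apply RtoC_inj in H; apply lt_0_INR in HP; lra.
Qed.

Lemma resonance_multiple (P : nat) (l : Z) :
  (0 < P)%nat -> resonance P (IZR (l * Z.of_nat P) / INR P) = 1%C.
Proof.
intros HP; pose proof (INR_neq_0_C P HP) as HPC.
assert (HPR := lt_0_INR P HP).
rewrite resonance_eq.
rewrite (sum_n_ext (G := C_AbelianMonoid) _ (fun _ => RtoC 1)).
- replace (sum_n (G := C_AbelianMonoid) (fun _ => RtoC 1) (P - 1)) with (RtoC (INR P)).
  { now apply Cinv_l. }
  replace P with (S (P - 1)) at 1 by lia.
  induction (P - 1)%nat as [|n IH]; [now rewrite sum_O |].
  rewrite sum_Sn, <- IH, (S_INR (S n)), RtoC_plus; reflexivity.
- intros j; apply unit_exp_eq_1; exists (l * Z.of_nat j)%Z.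
  rewrite !mult_IZR, <- !INR_IZR_INZ; field; lra.
Qed.

(** With [y = k / P], the ratio [unit_exp y] is a [P]-th root of unity other than
    [1], so the geometric sum over a full period vanishes. *)
Lemma resonance_not_multiple (P : nat) (k : Z) :
  (0 < P)%nat -> ~ (Z.of_nat P | k)%Z -> resonance P (IZR k / INR P) = 0%C.
Proof.
intros HP Hk; assert (HPR := lt_0_INR P HP).
rewrite resonance_eq.
set (y := IZR k / INR P).
assert (Hy : unit_exp y <> 1%C).
{ rewrite unit_exp_eq_1; intros [m Hm]; apply Hk; exists m.
  apply eq_IZR; rewrite mult_IZR, <- INR_IZR_INZ, <- Hm.
  unfold y; field; lra. }
pose proof (unit_exp_geometric y (P - 1)) as Hgeo.
replace (S (P - 1)) with P in Hgeo by lia.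
rewrite (proj2 (unit_exp_eq_1 (y * INR P))) in Hgeo.
2: { exists k; unfold y; field; lra. }
set (s := sum_n _ _) in *; clearbody s.
replace s with (/ (unit_exp y - 1) * ((unit_exp y - 1) * s))%C.
- rewrite Hgeo; ring.
- assert (unit_exp y - 1 <> 0)%C.
  { intros H; apply Hy; replace (unit_exp y) with (unit_exp y - 1 + 1)%C by ring.
    rewrite H; ring. }
  field; assumption.
Qed.

(** * Averaging the Fourier series over the points [j / P] *)

Lemma mean_fourier_terms (P : nat) (c : C) (k : Z) :
  (0 < P)%nat ->
  (/ INR P * sum_n (fun j => c * Cexp (2 * PI * Ci * IZR k * (INR j / INR P)%R))
               (P - 1))%C =
  (c * resonance P (IZR k / INR P))%C.
Proof.
intros HP.
rewrite resonance_eq, (sum_n_mult_l (K := C_Ring) c).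
change mult with Cmult.
rewrite !Cmult_assoc, (Cmult_comm (/ INR P)%C); f_equal.
apply sum_n_ext; intros j; unfold unit_exp; f_equal.
rewrite <- !Cmult_assoc, <- RtoC_mult; do 4 f_equal.
unfold Rdiv; ring.
Qed.

Theorem mainTheorem3
  (f : R -> C) (P : nat)
  (hper : forall x : R, f (x + 1) = f x)
  (habs : ex_sum all_int (fun k : Z => Cmod (fourier_coeff f k)))
  (hfourier : forall x : R,
     is_sum all_int
       (fun k : Z => (fourier_coeff f k * Cexp (2 * PI * Ci * IZR k * x))%C)
       (f x))
  (hP : (2 <= P)%nat) :
  exists S : C,
    is_sum nonzero_int
      (fun k : Z => (fourier_coeff f k * resonance P (IZR k / INR P))%C) S /\
    is_sum nonzero_int
      (fun l : Z => fourier_coeff f (l * Z.of_nat P)) S.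
Proof.
assert (HP : (0 < P)%nat) by lia.
assert (Hmean : is_sum all_int
  (fun k : Z => (fourier_coeff f k * resonance P (IZR k / INR P))%C)
  (/ INR P * sum_n (fun j => f (INR j / INR P)%R) (P - 1))%C).
{ eapply is_sum_ext.
  2: exact (is_sum_scal _ (/ INR P)%C _ _
              (is_sum_sum_n _ _ _ (P - 1) (fun j => hfourier (INR j / INR P)))).
  intros k _; exact (mean_fourier_terms P (fourier_coeff f k) k HP). }
apply (is_sum_remove _ nonzero_int _ _ 0%Z) in Hmean;
  [| exact I | intros k; unfold nonzero_int, all_int; tauto].
eexists; split; [exact Hmean |].
eapply is_sum_ext.
2: apply is_sum_reindex with (D := nonzero_int) (4 := Hmean)
     (phi := fun l => (l * Z.of_nat P)%Z) (psi := fun k => (k / Z.of_nat P)%Z).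
- intros l _; cbv beta; rewrite resonance_multiple by exact HP; apply Cmult_1_r.
- intros l; apply Z.div_mul; lia.
- intros l; unfold nonzero_int; nia.
- intros k _ Hk; rewrite resonance_not_multiple; [apply Cmult_0_r | exact HP |].
  intros [m ->]; apply Hk; rewrite Z.div_mul; lia.
Qed.
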